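(* Let $\mathbf{LC}$ be the category whose objects are locally finite coarse spaces and whose morphisms are closeness classes of coarse maps, and let $\mathbf{LFCM}$ be the category of LFCM spaces with closeness classes of coarse measurable maps as morphisms. The functor $\mathcal{P}\colon\mathbf{LC}\to\mathbf{LFCM}$ that sends a locally finite coarse space $(I,\mathcal{E}^I)$ to the LFCM space $(I,\mathcal{E}^I,\mathcal{P}(I))$, where $\mathcal{P}(I)$ is the power set of $I$ (and the class of a coarse map to the class of the same map), is an equivalence of categories.
   Context: A coarse structure on a set $X$ is a family $\mathcal{E}^X$ of subsets of $X\times X$ (entourages) containing the diagonal and closed under subsets, finite unions, transposes and compositions. $A\subset X$ is $E$-bounded if $A\times A\subset E$, bounded if it is $E$-bounded for some entourage $E$. A coarse space is locally finite if all its bounded subsets are finite. A map $f\colon X\to Y$ is coarse if $(f\times f)(E)\in\mathcal{E}^Y$ for all $E\in\mathcal{E}^X$; coarse maps $f,g$ are close if $(f\times g)(E)\in\mathcal{E}^Y$ for all $E\in\mathcal{E}^X$. A locally finite coarse measurable (LFCM) space is a triple $(X,\mathcal{E}^X,\mathfrak{A}^X)$ with $(X,\mathcal{E}^X)$ a coarse space and $\mathfrak{A}^X$ a Boolean algebra of subsets of $X$ for which there is a partition $\{A_i\}_{i\in I}$ of $X$ by elements of $\mathfrak{A}^X$ such that every bounded set meets finitely many $A_i$, all $A_i$ are $E$-bounded for a common entourage $E$, and $B\in\mathfrak{A}^X$ iff $B\cap A_i\in\mathfrak{A}^X$ for all $i$. A map $f\colon X\to Y$ between LFCM spaces is coarse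 measurable if it is coarse and $f^{-1}(\mathfrak{A}^Y)\subset\mathfrak{A}^X$. *)

(* Defs.v *)
From HB Require Import structures.
From mathcomp Require Import all_boot generic_quotient.
From mathcomp Require Import boolp classical_sets functions cardinality.

Set Implicit Arguments.
Unset Strict Implicit.
Unset Printing Implicit Defensive.

Local Open Scope classical_set_scope.
Local Open Scope quotient_scope.

Record category := Category {
  obj :> Type;
  hom : obj -> obj -> Type;
  idm : forall a, hom a a;
  compm : forall a b c, hom b c -> hom a b -> hom a c;
  comp1m : forall a b (f : hom a b), compm (idm b) f = f;
  compm1 : forall a b (f : hom a b), compm f (idm a) = f;
  compmA : forall a b c d (h : hom c d) (g : hom b c) (f : hom a b),
    compm h (compm g f) = compm (compm h g) f }.

Arguments hom {_} a b.
Arguments idm {_} a.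
Arguments compm {_ a b c} g f : rename.

Record functor (C D : category) := Functor {
  fobj :> C -> D;
  fmap : forall a b : C, hom a b -> hom (fobj a) (fobj b);
  fmap1 : forall a : C, fmap (idm a) = idm (fobj a);
  fmapM : forall (a b c : C) (g : hom b c) (f : hom a b),
    fmap (compm g f) = compm (fmap g) (fmap f) }.

Arguments fmap {C D} F {a b} f : rename.

Definition id_functor (C : category) : functor C C :=
  @Functor C C id (fun _ _ f => f) (fun _ => erefl) (fun _ _ _ _ _ => erefl).

Section comp_functor.
Variables (C D E : category) (G : functor D E) (F : functor C D).

Definition comp_fmap (a b : C) (f : hom a b) : hom (G (F a)) (G (F b)) :=
  fmap G (fmap F f).

Lemma comp_fmap1 (a : C) : comp_fmap (idm a) = idm (G (F a)).
Proof. by rewrite /comp_fmap !fmap1. Qed.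

Lemma comp_fmapM (a b c : C) (g : hom b c) (f : hom a b) :
  comp_fmap (compm g f) = compm (comp_fmap g) (comp_fmap f).
Proof. by rewrite /comp_fmap !fmapM. Qed.

Definition comp_functor : functor C E :=
  @Functor C E (fun a => G (F a)) comp_fmap comp_fmap1 comp_fmapM.

End comp_functor.

Definition is_iso (C : category) (a b : C) (f : hom a b) : Prop :=
  exists g : hom b a, compm g f = idm a /\ compm f g = idm b.

Definition is_natural (C D : category) (F G : functor C D)
    (t : forall a : C, hom (F a) (G a)) : Prop :=
  forall (a b : C) (f : hom a b), compm (t b) (fmap F f) = compm (fmap G f) (t a).

Definition naturally_isomorphic (C D : category) (F G : functor C D) : Prop :=
  exists t : forall a : C, hom (F a) (G a),
    is_natural t /\ forall a, is_iso (t a).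

Definition is_equivalence (C D : category) (F : functor C D) : Prop :=
  exists G : functor D C,
    naturally_isomorphic (comp_functor G F) (id_functor C) /\
    naturally_isomorphic (comp_functor F G) (id_functor D).

(* Closure under binary unions suffices for all finite unions: the empty union
   is an entourage, being a subset of the diagonal. *)
Record coarseSpace := CoarseSpace {
  carrier :> Type;
  entourage : set_system (carrier * carrier);
  entourage_diagonal : entourage diagonal;
  entourage_sub : forall E F, E `<=` F -> entourage F -> entourage E;
  entourageU : setU_closed entourage;
  entourageV : forall E, entourage E -> entourage (E^-1)%relation;
  entourage_comp : forall E F, entourage E -> entourage F ->
    entourage (E \; F)%relation }.

Section bounded.
Variable X : coarseSpace.

Definition bounded_by (E : set (X * X)) (A : set X) : Prop := A `*` A `<=` E.

Definition bounded (A : set X) : Prop :=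
  exists2 E, entourage E & bounded_by E A.

Definition locally_finite : Prop := forall A, bounded A -> finite_set A.

End bounded.

Section coarse.
Variables X Y : coarseSpace.

Definition prod_image (f g : X -> Y) (E : set (X * X)) : set (Y * Y) :=
  [set (f p.1, g p.2) | p in E].

Definition coarse (f : X -> Y) : Prop :=
  forall E, entourage E -> entourage (prod_image f f E).

Definition close (f g : X -> Y) : Prop :=
  forall E, entourage E -> entourage (prod_image f g E).

Lemma close_sym f g : close f g -> close g f.
Proof.
move=> fg E /entourageV /fg /entourageV; apply: entourage_sub.
by move=> _ [[x x'] /= Exx' <-]; exists (x', x).
Qed.

Lemma close_trans f g h : close f g -> close g h -> close f h.
Proof.
move=> fg gh E Een.
apply: entourage_sub (entourage_comp (gh _ (entourage_diagonal X)) (fg _ Een)).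
move=> _ [[x x'] /= Exx' <-].
by exists (g x') => /=; [exists (x, x')|exists (x', x')].
Qed.

End coarse.

Lemma coarse_id (X : coarseSpace) : coarse (fun x : X => x).
Proof.
by move=> E; apply: entourage_sub => _ [[x x'] /= Exx' <-].
Qed.

Lemma close_comp (X Y Z : coarseSpace) (g g' : Y -> Z) (f f' : X -> Y) :
  close g g' -> close f f' -> close (g \o f) (g' \o f').
Proof.
move=> gg' ff' E /ff' /gg'; apply: entourage_sub.
by move=> _ [[x x'] /= Exx' <-]; exists (f x, f' x') => //; exists (x, x').
Qed.

Lemma coarse_comp (X Y Z : coarseSpace) (g : Y -> Z) (f : X -> Y) :
  coarse g -> coarse f -> coarse (g \o f).
Proof. exact: close_comp. Qed.

Record coarseMap (X Y : coarseSpace) := CoarseMap {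
  coarse_fun :> X -> Y;
  coarse_funP : coarse coarse_fun }.

HB.instance Definition _ X Y := gen_eqMixin (coarseMap X Y).
HB.instance Definition _ X Y := gen_choiceMixin (coarseMap X Y).

Definition id_coarseMap (X : coarseSpace) : coarseMap X X :=
  CoarseMap (@coarse_id X).

Definition comp_coarseMap (X Y Z : coarseSpace)
    (g : coarseMap Y Z) (f : coarseMap X Y) : coarseMap X Z :=
  CoarseMap (coarse_comp (coarse_funP g) (coarse_funP f)).

Section closeness_class.
Variables X Y : coarseSpace.

Definition closeb : rel (coarseMap X Y) := fun f g => `[< close f g >].

Lemma closeb_refl : reflexive closeb.
Proof. by move=> f; apply/asboolP/coarse_funP. Qed.

Lemma closeb_sym : symmetric closeb.
Proof. by move=> f g; apply/asboolP/asboolP; apply: close_sym. Qed.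

Lemma closeb_trans : transitive closeb.
Proof.
by move=> g f h /asboolP fg /asboolP gh; apply/asboolP; apply: close_trans gh.
Qed.

Canonical closeb_equiv := EquivRel closeb closeb_refl closeb_sym closeb_trans.

Definition closenessClass := {eq_quot closeb}.

Lemma closenessP (f g : coarseMap X Y) :
  \pi_closenessClass f = \pi_closenessClass g <-> close f g.
Proof. by split=> [/eqmodP/asboolP //|fg]; apply/eqmodP/asboolP. Qed.

Lemma close_repr (f : coarseMap X Y) : close (repr (\pi_closenessClass f)) f.
Proof. by apply/closenessP; rewrite reprK. Qed.

End closeness_class.

Definition comp_class (X Y Z : coarseSpace)
    (g : closenessClass Y Z) (f : closenessClass X Y) : closenessClass X Z :=
  \pi_(closenessClass X Z) (comp_coarseMap (repr g) (repr f)).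

Lemma comp_class_pi (X Y Z : coarseSpace)
    (g : coarseMap Y Z) (f : coarseMap X Y) :
  comp_class (\pi_(closenessClass Y Z) g) (\pi_(closenessClass X Y) f) =
  \pi_(closenessClass X Z) (comp_coarseMap g f).
Proof. by apply/closenessP; apply: close_comp; apply: close_repr. Qed.

Definition id_class (X : coarseSpace) : closenessClass X X :=
  \pi_(closenessClass X X) (id_coarseMap X).

Lemma comp_class1m (X Y : coarseSpace) (f : closenessClass X Y) :
  comp_class (id_class Y) f = f.
Proof.
elim/quotW: f => f; rewrite comp_class_pi.
exact/closenessP/coarse_funP.
Qed.

Lemma comp_classm1 (X Y : coarseSpace) (f : closenessClass X Y) :
  comp_class f (id_class X) = f.
Proof.
elim/quotW: f => f; rewrite comp_class_pi.
exact/closenessP/coarse_funP.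
Qed.

Lemma comp_classmA (X Y Z W : coarseSpace) (h : closenessClass Z W)
    (g : closenessClass Y Z) (f : closenessClass X Y) :
  comp_class h (comp_class g f) = comp_class (comp_class h g) f.
Proof.
elim/quotW: f => f; elim/quotW: g => g; elim/quotW: h => h.
rewrite (comp_class_pi g f) (comp_class_pi h g).
rewrite (comp_class_pi h) (comp_class_pi _ f); apply/closenessP.
exact: (coarse_funP (comp_coarseMap h (comp_coarseMap g f))).
Qed.

Record lcSpace := LCSpace {
  lc_coarse :> coarseSpace;
  lc_locally_finite : locally_finite lc_coarse }.

Definition LC : category :=
  @Category lcSpace (fun X Y => closenessClass X Y) (fun X => id_class X)
    (fun X Y Z => @comp_class X Y Z) (fun X Y => @comp_class1m X Y)
    (fun X Y => @comp_classm1 X Y) (fun X Y Z W => @comp_classmA X Y Z W).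

Definition boolean_algebra (X : Type) (G : set_system X) : Prop :=
  [/\ G [set: X], setU_closed G & forall A, G A -> G (~` A)].

Definition lfcm_axiom (X : coarseSpace) (G : set_system X) : Prop :=
  exists (I : Type) (A : I -> set X),
    [/\ partition [set: I] A [set: X],
        forall i, G (A i),
        forall B, bounded B -> finite_set [set i | A i `&` B !=set0],
        (exists2 E, entourage E & forall i, bounded_by E (A i)) &
        forall B, G B <-> forall i, G (B `&` A i)].

Record lfcmSpace := LFCMSpace {
  lfcm_coarse :> coarseSpace;
  lfcm_algebra : set_system lfcm_coarse;
  lfcm_boolean : boolean_algebra lfcm_algebra;
  lfcm_partition : lfcm_axiom lfcm_algebra }.

Record cmMap (X Y : lfcmSpace) := CMMap {
  cm_coarse :> coarseMap X Y;
  cm_measurable : forall B : set Y,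
    lfcm_algebra B -> lfcm_algebra (cm_coarse @^-1` B) }.

HB.instance Definition _ X Y := gen_eqMixin (cmMap X Y).
HB.instance Definition _ X Y := gen_choiceMixin (cmMap X Y).

Definition id_cmMap (X : lfcmSpace) : cmMap X X :=
  @CMMap X X (id_coarseMap X) (fun B GB => GB).

Definition comp_cmMap (X Y Z : lfcmSpace)
    (g : cmMap Y Z) (f : cmMap X Y) : cmMap X Z :=
  @CMMap X Z (comp_coarseMap g f)
    (fun B GB => cm_measurable f (cm_measurable g GB)).

Section cm_class.
Variables X Y : lfcmSpace.

Definition cm_closeb : rel (cmMap X Y) := fun f g => closeb f g.

Lemma cm_closeb_refl : reflexive cm_closeb.
Proof. by move=> f; apply: closeb_refl. Qed.

Lemma cm_closeb_sym : symmetric cm_closeb.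
Proof. by move=> f g; apply: closeb_sym. Qed.

Lemma cm_closeb_trans : transitive cm_closeb.
Proof. by move=> g f h; apply: closeb_trans. Qed.

Canonical cm_closeb_equiv :=
  EquivRel cm_closeb cm_closeb_refl cm_closeb_sym cm_closeb_trans.

Definition cmClass := {eq_quot cm_closeb}.

Lemma cm_closenessP (f g : cmMap X Y) :
  \pi_cmClass f = \pi_cmClass g <-> close f g.
Proof.
split=> [/eqmodP fg|fg]; first exact/(asboolP (close f g)).
exact/eqmodP/(asboolP (close f g)).
Qed.

Lemma cm_close_repr (f : cmMap X Y) : close (repr (\pi_cmClass f)) f.
Proof. by apply/cm_closenessP; rewrite reprK. Qed.

End cm_class.

Definition comp_cmClass (X Y Z : lfcmSpace)
    (g : cmClass Y Z) (f : cmClass X Y) : cmClass X Z :=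
  \pi_(cmClass X Z) (comp_cmMap (repr g) (repr f)).

Lemma comp_cmClass_pi (X Y Z : lfcmSpace) (g : cmMap Y Z) (f : cmMap X Y) :
  comp_cmClass (\pi_(cmClass Y Z) g) (\pi_(cmClass X Y) f) =
  \pi_(cmClass X Z) (comp_cmMap g f).
Proof. by apply/cm_closenessP; apply: close_comp; apply: cm_close_repr. Qed.

Definition id_cmClass (X : lfcmSpace) : cmClass X X :=
  \pi_(cmClass X X) (id_cmMap X).

Lemma comp_cmClass1m (X Y : lfcmSpace) (f : cmClass X Y) :
  comp_cmClass (id_cmClass Y) f = f.
Proof.
elim/quotW: f => f; rewrite comp_cmClass_pi.
exact/cm_closenessP/coarse_funP.
Qed.

Lemma comp_cmClassm1 (X Y : lfcmSpace) (f : cmClass X Y) :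
  comp_cmClass f (id_cmClass X) = f.
Proof.
elim/quotW: f => f; rewrite comp_cmClass_pi.
exact/cm_closenessP/coarse_funP.
Qed.

Lemma comp_cmClassmA (X Y Z W : lfcmSpace)
    (h : cmClass Z W) (g : cmClass Y Z) (f : cmClass X Y) :
  comp_cmClass h (comp_cmClass g f) = comp_cmClass (comp_cmClass h g) f.
Proof.
elim/quotW: f => f; elim/quotW: g => g; elim/quotW: h => h.
rewrite (comp_cmClass_pi g f) (comp_cmClass_pi h g).
rewrite (comp_cmClass_pi h) (comp_cmClass_pi _ f); apply/cm_closenessP.
exact: (coarse_funP (comp_cmMap h (comp_cmMap g f))).
Qed.

Definition LFCM : category :=
  Category comp_cmClass1m comp_cmClassm1 comp_cmClassmA.

Lemma powerset_boolean (X : Type) : boolean_algebra [set: set X].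
Proof. by []. Qed.

Lemma powerset_lfcm (X : lcSpace) : @lfcm_axiom X [set: set X].
Proof.
exists X, (fun x => [set x]); split=> //.
- split=> [|x y _ _ [z [/= -> //]]|x _]; last by exists x.
  by rewrite predeqE => x; split=> // _; exists x.
- move=> B /lc_locally_finite; apply: sub_finite_set.
  by move=> x [_ [/= -> ]].
- exists diagonal; first exact: entourage_diagonal.
  by move=> x [y z] [/= -> ->].
Qed.

Definition powerset_space (X : lcSpace) : lfcmSpace :=
  LFCMSpace (@powerset_boolean X) (powerset_lfcm X).

Definition powerset_map (X Y : lcSpace) (f : coarseMap X Y) :
  cmMap (powerset_space X) (powerset_space Y) :=
  @CMMap (powerset_space X) (powerset_space Y) f (fun _ _ => Logic.I).

Definition powerset_class (X Y : lcSpace) (f : closenessClass X Y) :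
    cmClass (powerset_space X) (powerset_space Y) :=
  \pi_(cmClass (powerset_space X) (powerset_space Y)) (powerset_map (repr f)).

Lemma powerset_class_pi (X Y : lcSpace) (f : coarseMap X Y) :
  powerset_class (\pi_(closenessClass X Y) f) =
  \pi_(cmClass (powerset_space X) (powerset_space Y)) (powerset_map f).
Proof. by apply/cm_closenessP; apply: close_repr. Qed.

Lemma powerset_class1 (X : lcSpace) :
  powerset_class (id_class X) = id_cmClass (powerset_space X).
Proof. by rewrite powerset_class_pi; apply/cm_closenessP/coarse_id. Qed.

Lemma powerset_classM (X Y Z : lcSpace)
    (g : closenessClass Y Z) (f : closenessClass X Y) :
  powerset_class (comp_class g f) =
  comp_cmClass (powerset_class g) (powerset_class f).
Proof.
elim/quotW: f => f; elim/quotW: g => g.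
rewrite (comp_class_pi g f) (powerset_class_pi g) (powerset_class_pi f).
rewrite (powerset_class_pi (comp_coarseMap g f)) comp_cmClass_pi.
exact/cm_closenessP/(coarse_funP (comp_coarseMap g f)).
Qed.

Definition powerset_functor : functor LC LFCM :=
  @Functor LC LFCM powerset_space powerset_class
    powerset_class1 powerset_classM.

(* Main.v *)
From HB Require Import structures.
From mathcomp Require Import all_boot generic_quotient.
From mathcomp Require Import boolp classical_sets functions cardinality.
Require Import Defs.

(** On objects of the form [P(I)] measurability is no condition, so [P] is fully
    faithful. An LFCM space [X] with uniformly bounded measurable partition
    [A : I -> set X] is isomorphic to [P(I)], where [I] carries the coarse
    structure pulled back along a choice of points [a i] in [A i]: the inverse
    of [a] sends [x] to the index of the cell containing [x], and [a] of that
    index lies in the same cell as [x]. *)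

Set Implicit Arguments.
Unset Strict Implicit.
Unset Printing Implicit Defensive.

Local Open Scope classical_set_scope.
Local Open Scope quotient_scope.

(** Choice turns essential surjectivity into an object map [G] with isomorphisms [e d] from
    [F (G d)] to [d], and fullness into a section [lift] of [fmap F]. The inverse functor lifts
    conjugates by [e]; by faithfulness, equations in [C] can be checked after applying [F]. *)
Lemma fully_faithful_essentially_surjective_equivalence
    (C D : category) (F : functor C D) :
  (forall (a b : C) (g : hom (F a) (F b)), exists f, fmap F f = g) ->
  (forall (a b : C) (f f' : hom a b), fmap F f = fmap F f' -> f = f') ->
  (forall d : D, exists (c : C) (e : hom (F c) d), is_iso e) ->
  is_equivalence F.
Proof.
move=> full faithful esssurj.
pose lift a b (g : hom (F a) (F b)) := projT1 (cid (full a b g)).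
have liftK a b (g : hom (F a) (F b)) : fmap F (lift a b g) = g.
  exact: projT2 (cid (full a b g)).
pose G d := projT1 (cid (esssurj d)).
have eP d : exists e : hom (F (G d)) d, is_iso e := projT2 (cid (esssurj d)).
pose e d := projT1 (cid (eP d)).
have e_iso d : is_iso (e d) := projT2 (cid (eP d)).
pose e' d := projT1 (cid (e_iso d)).
have e'e d : compm (e' d) (e d) = idm _ := (projT2 (cid (e_iso d))).1.
have ee' d : compm (e d) (e' d) = idm _ := (projT2 (cid (e_iso d))).2.
pose Gmap a b (f : hom a b) := lift (G a) (G b) (compm (e' b) (compm f (e a))).
have Gmap1 a : Gmap a a (idm a) = idm (G a).
  by apply: faithful; rewrite liftK comp1m e'e fmap1.
have GmapM a b c (g : hom b c) (f : hom a b) :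
    Gmap a c (compm g f) = compm (Gmap b c g) (Gmap a b f).
  apply: faithful; rewrite fmapM !liftK -!compmA; congr (compm _ (compm _ _)).
  by rewrite (compmA (e b)) ee' comp1m.
exists (Functor Gmap1 GmapM); split.
(* The isomorphism [e (F c)] lives in [D] between objects in the image of [F], so it lifts to [C],
   and so does its inverse. *)
- exists (fun c => lift (G (F c)) c (e (F c))); split=> [a b f|c].
    apply: faithful; rewrite !fmapM !liftK.
    by rewrite (compmA (e (F b))) ee' comp1m.
  exists (lift c (G (F c)) (e' (F c))).
  by split; apply: faithful; rewrite fmapM !liftK fmap1 ?e'e ?ee'.
- exists e; split=> // a b f /=.
  by rewrite /comp_fmap /= liftK compmA ee' comp1m.
Qed.

Lemma powerset_functor_full (X Y : LC)
    (g : hom (powerset_functor X) (powerset_functor Y)) :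
  exists f, fmap powerset_functor f = g.
Proof.
elim/quotW: g => g; exists (\pi_(closenessClass X Y) (cm_coarse g)).
rewrite /= powerset_class_pi; apply/cm_closenessP; exact: (coarse_funP g).
Qed.

Lemma powerset_functor_faithful (X Y : LC) (f f' : hom X Y) :
  fmap powerset_functor f = fmap powerset_functor f' -> f = f'.
Proof.
elim/quotW: f => f; elim/quotW: f' => f'.
rewrite /= !powerset_class_pi => /cm_closenessP ff'; exact/closenessP.
Qed.

Section pullback.
Variables (X : coarseSpace) (I : Type) (a : I -> X).

(** This is the largest coarse structure on [I] that makes [a] coarse. *)
Definition pullback_entourage : set_system (I * I) :=
  [set E | entourage [set (a p.1, a p.2) | p in E]].

Lemma pullback_diagonal : pullback_entourage diagonal.
Proof.
apply: entourage_sub (entourage_diagonal X).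
by move=> _ [[i j] /= ij <-]; move: ij; rewrite /diagonal /= => ->.
Qed.

Lemma pullback_sub E F :
  E `<=` F -> pullback_entourage F -> pullback_entourage E.
Proof. by move=> EF; apply: entourage_sub; apply: image_subset. Qed.

Lemma pullbackU : setU_closed pullback_entourage.
Proof.
move=> E F EE EF; rewrite /pullback_entourage /= image_setU.
exact: entourageU.
Qed.

Lemma pullbackV E : pullback_entourage E -> pullback_entourage (E^-1)%relation.
Proof.
move=> /entourageV; apply: entourage_sub.
by move=> _ [[i j] /= Eij <-]; exists (j, i).
Qed.

Lemma pullback_comp E F : pullback_entourage E -> pullback_entourage F ->
  pullback_entourage (E \; F)%relation.
Proof.
move=> EE EF; apply: entourage_sub (entourage_comp EE EF).
by move=> _ [[i j] /= [k Fik Ekj] <-]; exists (a k); [exists (i, k)|exists (k, j)].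
Qed.

Definition pullback_coarse : coarseSpace :=
  CoarseSpace pullback_diagonal pullback_sub pullbackU pullbackV pullback_comp.

End pullback.

Lemma powerset_functor_essentially_surjective (X : LFCM) :
  exists (J : LC) (e : hom (powerset_functor J) X), is_iso e.
Proof.
have [I [A [[Acover Atriv A0] GA Afin [E0 E0ent E0A] Gloc]]] :=
  lfcm_partition X.
have A0' i : exists x, A i x by case: (A0 i Logic.I) => x; exists x.
have [a aA] := choice A0'.
have /choice[p pA] (x : lfcm_coarse X) : exists i, A i x.
  have : [set: lfcm_coarse X] x by [].
  by rewrite -Acover => -[i _ Aix]; exists i.
have A_inj i j x : A i x -> A j x -> i = j.
  by move=> Aix Ajx; apply: Atriv => //; exists x.
pose J0 := pullback_coarse a.
have J0fin : locally_finite J0.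
  move=> B [E Eent BE].
  apply: (@sub_finite_set _ _ [set i | A i `&` (a @` B) !=set0]).
    by move=> i Bi /=; exists (a i); split=> //; exists i.
  apply: Afin; exists [set (a q.1, a q.2) | q in E] => //.
  move=> [x y] [/= [i Bi <-] [j Bj <-]].
  by exists (i, j) => //; apply: BE.
pose J := LCSpace J0fin.
have a_coarse : @coarse J0 X a by [].
have ap_close : @close X X (a \o p) id.
  (* The pair [(a (p x), y)] factors through [x]: the first leg stays in the cell [A (p x)], hence
     in [E0], and the second is in [E]. *)
  move=> E Eent; apply: entourage_sub (entourage_comp Eent E0ent).
  move=> _ [[x y] /= Exy <-]; exists x => //.
  by apply: (E0A (p x)); split=> //=.
have p_coarse : @coarse X J0 p.
  (* Being close to itself, [a \o p] is coarse; for the pulled back structure this says that [p] is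
     coarse. *)
  move=> E /(close_trans ap_close (close_sym ap_close)).
  apply: entourage_sub.
  by move=> _ [_ [[x y] /= Exy <-] <-]; exists (x, y).
have [GT _ GC] := lfcm_boolean X.
have p_meas (B : set J0) : lfcm_algebra (p @^-1` B).
  (* Since [p] is constantly [i] on [A i], the preimage of [B] meets [A i] in all of [A i] or in
     nothing. *)
  apply/Gloc => i; have [Bi|nBi] := pselect (B i).
    suff -> : p @^-1` B `&` A i = A i by [].
    apply/setIidr => x Aix /=.
    by rewrite (A_inj _ _ _ (pA x) Aix).
  suff -> : p @^-1` B `&` A i = ~` [set: X] by apply: GC.
  rewrite setCT; apply/seteqP; split=> // x [/= Bpx Aix].
  by apply: nBi; rewrite -(A_inj _ _ _ (pA x) Aix).
pose am : cmMap (powerset_space J) X :=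
  @CMMap (powerset_space J) X (CoarseMap a_coarse) (fun _ _ => Logic.I).
pose pm : cmMap X (powerset_space J) :=
  @CMMap X (powerset_space J) (CoarseMap p_coarse) (fun B _ => p_meas B).
exists J, (\pi_(cmClass (powerset_space J) X) am).
exists (\pi_(cmClass X (powerset_space J)) pm); split.
(* Here [p (a i) = i] holds exactly, whereas [a \o p] is only known to be close to the identity. *)
- rewrite /= comp_cmClass_pi; apply/cm_closenessP => /= E.
  apply: pullback_sub => _ [[i j] /= Eij <-].
  by rewrite (A_inj _ _ _ (pA (a i)) (aA i)).
- by rewrite /= comp_cmClass_pi; apply/cm_closenessP.
Qed.

Theorem corollary1p10 : is_equivalence powerset_functor.
Proof.
apply: fully_faithful_essentially_surjective_equivalence.
- exact: powerset_functor_full.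
- exact: powerset_functor_faithful.
- exact: powerset_functor_essentially_surjective.
Qed.
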